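(* Let $\mathcal H$ be a separable Hilbert space and $\{f_i\}_{i=1}^\infty,\{g_i\}_{i=1}^\infty\subseteq\mathcal H$. Suppose that $\{f_i\}_{i=1}^\infty$ is a frame for $\mathcal H$ containing a Riesz basis, that $\{g_i\}_{i=1}^\infty$ is total in $\mathcal H$, and that the perturbation operator $K\{c_i\}=\sum_{i} c_i(f_i-g_i)$ is (well defined and) compact as a mapping from $l^2(\mathbf N)$ into $\mathcal H$. Then $\{g_i\}_{i=1}^\infty$ is a frame for $\mathcal H$ containing a Riesz basis, and the frames $\{f_i\}_{i=1}^\infty$ and $\{g_i\}_{i=1}^\infty$ have the same excess.
   Context: A countable family $\{f_i\}_{i\in I}$ in $\mathcal H$ is a frame for $\mathcal H$ if there are $A,B>0$ with $A\|f\|^2\le\sum_{i\in I}|\langle f,f_i\rangle|^2\le B\|f\|^2$ for all $f\in\mathcal H$. A Riesz basis for $\mathcal H$ is a family which is the image of an orthonormal basis of $\mathcal H$ under a bounded invertible operator on $\mathcal H$. A frame $\{f_i\}_{i=1}^\infty$ contains a Riesz basis if some subfamily $\{f_i\}_{i\in \mathbf N\setminus\sigma}$ is a Riesz basis for $\mathcal H$; its excess is then the number of elements (finite, or infinite) of $\sigma$, i.e. the number of elements that have to be removed to obtain a Riesz basis. A family is total if its closed linear span is $\mathcal H$. *)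

(* Defs.v *)
From mathcomp Require Import all_boot all_order all_algebra.
From mathcomp Require Import complex.
From mathcomp Require Import all_classical all_reals all_analysis.

Set Implicit Arguments.
Unset Strict Implicit.
Unset Printing Implicit Defensive.

Import Order.TTheory GRing.Theory Num.Theory.
Import numFieldNormedType.Exports.

Local Open Scope classical_set_scope.
Local Open Scope ring_scope.

(** Hilbert spaces are taken over either the real or the complex numbers; the
    two cases are treated uniformly.  Norms, sums of squares and frame bounds
    live in the scalar field itself: over the complex numbers, [0 <= x] forces
    [x] to be real, and [`|x|] is the modulus seen as a complex number. *)
Variant scalar_kind := RealScalars | ComplexScalars.

Definition scalars (R : realType) (k : scalar_kind) : numFieldType :=
  match k with
  | RealScalars => R
  | ComplexScalars => R[i]%C
  end.

Definition scalar_conj (R : realType) (k : scalar_kind) :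
    scalars R k -> scalars R k :=
  match k return scalars R k -> scalars R k with
  | RealScalars => idfun
  | ComplexScalars => fun z : R[i]%C => Num.conj z
  end.

Section Families.
Variables (K : numFieldType) (H : normedModType K).
Implicit Types (f h : nat -> H) (A : set nat) (c : nat -> K).

Definition separable_space : Prop := exists2 D : set H, countable D & dense D.

Definition finite_span A f : set H :=
  [set x | exists n c, x = \sum_(0 <= i < n | i \in A) c i *: f i].

Definition total_family A f : Prop := closure (finite_span A f) = setT.

Definition bounded_operator (T : H -> H) : Prop :=
  exists M : K, forall x, `|T x| <= M * `|x|.

Definition l2 : set (nat -> K) :=
  [set c : nat -> K | cvgn (series (fun i => `|c i| ^+ 2))].

Definition l2_unit_ball : set (nat -> K) :=
  [set c : nat -> K | l2 c /\ limn (series (fun i => `|c i| ^+ 2)) <= 1].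

Definition synthesis h c : H := limn (series (fun i => c i *: h i)).

Definition synthesis_well_defined h : Prop :=
  forall c, l2 c -> cvgn (series (fun i => c i *: h i)).

(** [synthesis h] is linear on [l2] whenever it is well defined, so compactness
    amounts to mapping the unit ball to a relatively compact set. *)
Definition synthesis_compact h : Prop :=
  precompact (synthesis h @` l2_unit_ball).

End Families.

Section Frames.
Variables (K : numFieldType) (conj : K -> K) (H : normedModType K).
Variable (ip : {dot H for conj}).
Implicit Types (f e : nat -> H) (A : set nat).

Definition frame f : Prop :=
  exists a b : K, [/\ 0 < a, 0 < b & forall x : H,
    let s := series (fun i => `|ip x (f i)| ^+ 2) in
    [/\ cvgn s, a * `|x| ^+ 2 <= limn s & limn s <= b * `|x| ^+ 2]].

Definition orthonormal_basis A e : Prop :=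
  (forall i j, A i -> A j -> ip (e i) (e j) = (i == j)%:R) /\ total_family A e.

(** The subfamily [(f i)_(i in A)] is a Riesz basis of [H]; the values of [f]
    outside [A] are irrelevant.  "Invertible" means having an inverse that is
    again a bounded linear operator. *)
Definition riesz_basis A f : Prop :=
  exists (e : nat -> H) (T S : {linear H -> H}),
    [/\ orthonormal_basis A e, bounded_operator T, bounded_operator S,
        cancel T S /\ cancel S T & forall i, A i -> f i = T (e i)].

Definition contains_riesz_basis f : Prop :=
  exists sigma : set nat, riesz_basis (~` sigma) f.

(** Value of the excess of a frame containing a Riesz basis: [Some n] for a
    finite excess [n], [None] for an infinite one. *)
Definition has_excess f (m : option nat) : Prop :=
  exists2 sigma : set nat, riesz_basis (~` sigma) f &
    match m with
    | Some n => (sigma #= `I_n)%card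
    | None => infinite_set sigma
    end.

End Frames.

(* Main.v *)
Require Import Defs.
From HB Require Import structures.
From mathcomp Require Import all_boot all_order all_algebra.
From mathcomp Require Import finmap complex.
From mathcomp Require Import all_classical all_reals all_analysis.
From mathcomp Require Import ring lra.
Set Implicit Arguments.
Unset Strict Implicit.
Unset Printing Implicit Defensive.
Import Order.TTheory GRing.Theory Num.Theory.
Import numFieldNormedType.Exports.
Local Open Scope classical_set_scope.
Local Open Scope ring_scope.


(** A compact perturbation changes the problem only at finitely many indices, up
    to an arbitrarily small error, and finitely many basis vectors can be
    exchanged one at a time.

    Write [h i = f i - g i]. The tails of [h] are small: for every [d > 0] there
    is an [N] such that synthesis along [h] has norm at most [d] on coefficients
    supported beyond [N] ([compact_tail_bound]). Otherwise unit coefficient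
    blocks supported further and further out would have images bounded away from
    zero and accumulating at one point; the sum of [L] disjoint blocks has norm
    at most the square root of [L], but its image would have norm of order [L].

    Let the complement [A] of [sigma] index a Riesz basis in [f], with
    [f i = T (e i)] for an invertible [T] and an orthonormal basis [e]. The
    operator [D] sending [e i] to [h i] for [i >= N] and to [0] for [i < N] is
    then so small that [T - D] is invertible by a Neumann series
    ([tail_perturbation]). It sends [e i] to [g i] for [i >= N]. The remaining
    finitely many vectors are replaced by members of [g] as in the Steinitz
    exchange lemma ([steinitz_exchange]): totality of [g] provides a member with
    a nonzero coordinate along the vector to be replaced, and the replacement is
    an invertible rank-one modification. The result is a Riesz basis contained
    in [g]. Its index set agrees with [A] except for an exchange of equally many
    indices, so both complements have the same cardinality
    ([riesz_basis_transfer]).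

    The excess of [g] is determined by [g] alone. If [g] contains two Riesz
    bases with index sets [A1] and [A2], the coordinate functionals of the
    first along [A1 `\` A2] vanish on the vectors common to both bases, and
    linear algebra bounds their number by that of the vectors along [A2 `\` A1]
    ([riesz_basis_difference_le]). Hence, when one complement is finite, both
    have the same number of elements ([riesz_basis_complement_card]).

    That [g] is a frame follows from the Bessel bounds of [f] and [h] on one side
    ([bessel_boundB]), and from the Riesz basis contained in [g] on the other
    ([riesz_basis_lower_bound]).

    All estimates are carried out with real numbers, through the real value [nm]
    of the norm, which makes real and complex scalars uniform. *)

(** * Real values of scalars and real-valued norms *)

Section Scalars.
Variables (R : realType) (k : scalar_kind).
Local Notation K := (scalars R k).

Definition real_value : K -> R :=
  match k return scalars R k -> R with
  | RealScalars => idfun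
  | ComplexScalars => fun z : R[i]%C => complex.Re z
  end.

Definition of_real : R -> K :=
  match k return R -> scalars R k with
  | RealScalars => idfun
  | ComplexScalars => fun x : R => (x%:C)%C
  end.

Lemma of_realK : cancel of_real real_value.
Proof. by rewrite /of_real /real_value; case: k. Qed.

Lemma real_valueK (z : K) : 0 <= z -> of_real (real_value z) = z.
Proof.
rewrite /of_real /real_value /scalars; case: k z => //= z z0.
by rewrite RRe_real// ger0_real.
Qed.

Lemma of_realD : {morph of_real : x y / x + y}.
Proof. by rewrite /of_real /scalars; case: k => //= x y; rewrite rmorphD. Qed.

Lemma of_realM : {morph of_real : x y / x * y}.
Proof. by rewrite /of_real /scalars; case: k => //= x y; rewrite rmorphM. Qed.

Lemma of_real0 : of_real 0 = 0.
Proof. by rewrite /of_real /scalars; case: k. Qed.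

Lemma of_real1 : of_real 1 = 1.
Proof. by rewrite /of_real /scalars; case: k. Qed.

Lemma of_realX n : {morph of_real : x / x ^+ n}.
Proof.
by move=> x; elim: n => [|n ih]; rewrite ?expr0 ?of_real1// !exprS of_realM ih.
Qed.

Lemma of_real_le x y : (of_real x <= of_real y) = (x <= y).
Proof.
by rewrite /of_real /scalars; case: k => //=; rewrite lecE eqxx.
Qed.

Lemma of_real_lt x y : (of_real x < of_real y) = (x < y).
Proof.
by rewrite /of_real /scalars; case: k => //=; rewrite ltcE eqxx.
Qed.

Lemma of_real_norm x : `|of_real x| = of_real `|x|.
Proof.
rewrite /of_real /scalars; case: k => //=; rewrite normc_def /=.
by rewrite expr0n /= addr0 sqrtr_sqr.
Qed.

Lemma of_real_inj : injective of_real.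
Proof. exact: can_inj of_realK. Qed.

Lemma real_valueD : {morph real_value : x y / x + y}.
Proof. by rewrite /real_value; case: k => //= -[a b] [c d]. Qed.

Lemma real_value0 : real_value 0 = 0.
Proof. by rewrite -of_real0 of_realK. Qed.

Lemma real_value_ge0 (z : K) : 0 <= z -> 0 <= real_value z.
Proof. by move=> z0; rewrite -of_real_le real_valueK// of_real0. Qed.

Lemma real_value_gt0 (z : K) : 0 < z -> 0 < real_value z.
Proof. by move=> z0; rewrite -of_real_lt real_valueK ?ltW// of_real0. Qed.

Lemma real_valueN (x : K) : real_value (- x) = - real_value x.
Proof. by apply/eqP; rewrite -addr_eq0 -real_valueD addNr real_value0. Qed.

Lemma real_valueB (x y : K) : real_value (x - y) = real_value x - real_value y.
Proof. by rewrite real_valueD real_valueN. Qed.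

Lemma real_value_le (x y : K) : x <= y -> real_value x <= real_value y.
Proof.
by rewrite -subr_ge0 => /real_value_ge0; rewrite real_valueB subr_ge0.
Qed.

Lemma norm_real_value_le (x : K) : `|real_value x| <= real_value `|x|.
Proof.
rewrite /real_value; move: x; rewrite /scalars; case: k => //= x.
have := normc_ge_Re x; rewrite lecE /= => /andP[_].
by case: x => a b; rewrite /Num.norm /=.
Qed.

Lemma real_value_sum (I : Type) (r : seq I) (P : pred I) (F : I -> K) :
  real_value (\sum_(i <- r | P i) F i) = \sum_(i <- r | P i) real_value (F i).
Proof. exact: (big_morph _ real_valueD real_value0). Qed.

Lemma mul_conj (z : K) : z * scalar_conj z = `|z| ^+ 2.
Proof.
rewrite /scalar_conj /scalars; case: k z => /= z; last by rewrite normCK.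
by rewrite real_normK ?num_real// expr2.
Qed.

Lemma norm_conj (z : K) : `|scalar_conj z| = `|z|.
Proof.
by rewrite /scalar_conj /scalars; case: k z => //= z; rewrite norm_conjC.
Qed.

Lemma conj0 : scalar_conj (0 : K) = 0.
Proof. by rewrite /scalar_conj; case: k => //=; rewrite conjC0. Qed.

End Scalars.

Section RealNorm.
Variables (R : realType) (k : scalar_kind).
Local Notation K := (scalars R k).

(** The norm of a [K]-normed space takes its values in [K]; its real value lives
    in a totally ordered field, where estimates can be computed. *)
Definition nm (V : normedModType K) (x : V) : R := real_value `|x|.

Section Theory.
Variable V : normedModType K.
Implicit Types x y : V.

Lemma of_real_nm x : of_real k (nm x) = `|x|.
Proof. exact: real_valueK. Qed.

Lemma nm_ge0 x : 0 <= nm x.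
Proof. exact: real_value_ge0. Qed.

Lemma nm0 : nm (0 : V) = 0.
Proof. by rewrite /nm normr0 real_value0. Qed.

Lemma nm_eq0 x : nm x = 0 -> x = 0.
Proof. by move=> h; apply/eqP; rewrite -normr_eq0 -of_real_nm h of_real0. Qed.

Lemma nmD x y : nm (x + y) <= nm x + nm y.
Proof. by rewrite -(of_real_le k) of_realD !of_real_nm ler_normD. Qed.

Lemma nmN x : nm (- x) = nm x.
Proof. by rewrite /nm normrN. Qed.

Lemma nm_distC x y : nm (x - y) = nm (y - x).
Proof. by rewrite /nm distrC. Qed.

Lemma nmB x y : nm (x - y) <= nm x + nm y.
Proof. by rewrite -[nm y]nmN nmD. Qed.

Lemma nmZ (a : K) x : nm (a *: x) = real_value `|a| * nm x.
Proof.
by apply: (@of_real_inj R k); rewrite of_realM !of_real_nm normrZ real_valueK.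
Qed.

Lemma le_nmB x y : nm x - nm y <= nm (x - y).
Proof. by have := nmD (x - y) y; rewrite subrK; lra. Qed.

Lemma nm_sum (I : Type) (r : seq I) (P : pred I) (F : I -> V) :
  nm (\sum_(i <- r | P i) F i) <= \sum_(i <- r | P i) nm (F i).
Proof.
elim/big_ind2: _ => [|a b c d ha hb|//]; first by rewrite nm0.
by apply: le_trans (nmD _ _) _; apply: lerD.
Qed.

Lemma cvg_nmP (u : nat -> V) (l : V) :
  u @ \oo --> l <->
  forall e : R, 0 < e -> exists N, forall n, (N <= n)%N -> nm (l - u n) < e.
Proof.
rewrite cvgrPdist_lt; split=> [h e e0|h e e0].
  have /h[N _ hN] : 0 < of_real k e by rewrite -[0](of_real0 R k) of_real_lt.
  by exists N => n /hN /=; rewrite -of_real_nm of_real_lt.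
have [N hN] := h _ (real_value_gt0 e0).
exists N => // n /= /hN; rewrite -(of_real_lt k) of_real_nm real_valueK//.
exact: ltW.
Qed.

Lemma closure_nmP (A : set V) x :
  closure A x <-> forall e : R, 0 < e -> exists2 y, A y & nm (x - y) < e.
Proof.
split=> [h e e0|h B].
  have e0' : 0 < of_real k e by rewrite -[0](of_real0 R k) of_real_lt.
  have [y [Ay]] := h _ (nbhsx_ballx x _ e0').
  by rewrite -ball_normE /ball_ /= -of_real_nm of_real_lt => ?; exists y.
case/nbhs_ballP => e /= e0 heB.
have [y Ay xy] := h _ (real_value_gt0 e0); exists y; split=> //; apply: heB.
rewrite -ball_normE /ball_ /= -of_real_nm -(real_valueK (ltW e0)).
by rewrite of_real_lt.
Qed.

Lemma nm_lim_le (u : nat -> V) l M :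
  u @ \oo --> l -> (forall n, nm (u n) <= M) -> nm l <= M.
Proof.
move=> /cvg_nmP ul uM; apply/ler_addgt0Pr => e e0; have [N hN] := ul _ e0.
have := hN N (leqnn N); have := uM N; have := le_nmB l (u N); lra.
Qed.

End Theory.

Lemma cauchy_nm_cvgn (V : completeNormedModType K) (u : nat -> V) :
  (forall e : R, 0 < e ->
    exists N, forall n, (N <= n)%N -> nm (u N - u n) < e) ->
  cvgn u.
Proof.
move=> h; apply/cauchy_cvgP; apply: cauchy_exP => e /= e0.
have [N hN] := h _ (real_value_gt0 e0); exists (u N).
exists N => // n /= /hN; rewrite -ball_normE /ball_ /=.
by rewrite -(of_real_lt k) of_real_nm real_valueK// ltW.
Qed.

Lemma nm_scalar (a : K) : nm (a : K) = real_value `|a|.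
Proof. by []. Qed.

Lemma nmM (a b : K) : nm (a * b) = nm a * nm b.
Proof. exact: (nmZ a b). Qed.

Lemma nm_of_real (x : R) : nm (of_real k x) = `|x|.
Proof. by rewrite /nm of_real_norm of_realK. Qed.

Lemma nm_sqr (V : normedModType K) (x : V) : `|x| ^+ 2 = of_real k (nm x ^+ 2).
Proof. by rewrite of_realX of_real_nm. Qed.

Lemma nm_conj (a : K) : nm (scalar_conj a : K) = nm a.
Proof. by rewrite /nm norm_conj. Qed.

Lemma of_real_sum (I : Type) (r : seq I) (P : pred I) (F : I -> R) :
  of_real k (\sum_(i <- r | P i) F i) = \sum_(i <- r | P i) of_real k (F i).
Proof. exact: (big_morph _ (@of_realD R k) (@of_real0 R k)). Qed.

(** Scalars need not be totally ordered, so the limit is first found among the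
    real numbers. *)
Lemma nonneg_series_cvgn (a : nat -> R) (b : R) : (forall i, 0 <= a i) ->
  (forall n, \sum_(0 <= i < n) a i <= b) ->
  exists2 s : R, series (fun i => of_real k (a i)) @ \oo --> of_real k s &
    (forall n, \sum_(0 <= i < n) a i <= s) /\ s <= b.
Proof.
move=> a0 ab.
have nd : {homo series a : n m / (n <= m)%N >-> n <= m}.
  by apply/nondecreasing_seqP => n; rewrite seriesEnat/= big_nat_recr//= lerDl.
have cv : cvgn (series a).
  apply: nondecreasing_is_cvgn => //; exists b => _ [n _ <-].
  exact: ab.
exists (limn (series a)); last split.
- apply/cvg_nmP => e e0.
  have /cvgrPdist_lt/(_ _ e0)[N _ hN] := cv.
  exists N => n /hN /=; rewrite seriesEnat/= seriesEnat/= -of_real_sum.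
  set s := limn _; rewrite -[of_real k s - _]/(of_real k s + - _).
  have -> : - of_real k (\sum_(0 <= k0 < n) a k0) =
            of_real k (- (\sum_(0 <= k0 < n) a k0)).
    by apply/eqP; rewrite eq_sym -addr_eq0 -of_realD addNr of_real0.
  by rewrite -of_realD nm_of_real.
- by move=> n; exact: (nondecreasing_cvgn_le nd cv n).
- by apply: limr_le => //; apply: nearW => n; exact: ab.
Qed.

Lemma nonneg_series_partial (a : nat -> R) (l : K) : (forall i, 0 <= a i) ->
  series (fun i => of_real k (a i)) @ \oo --> l ->
  forall n, \sum_(0 <= i < n) a i <= real_value l.
Proof.
move=> a0 /cvg_nmP al n; apply/ler_addgt0Pr => e e0.
have [N hN] := al _ e0; have := hN _ (leq_maxl N n).
rewrite seriesEnat /= -of_real_sum => h.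
set s := \sum_(0 <= i < maxn N n) a i in h.
have ns : \sum_(0 <= i < n) a i <= s.
  rewrite /s (big_cat_nat (leq0n n) (leq_maxr N n))/= lerDl.
  by apply: sumr_ge0.
have := le_lt_trans (norm_real_value_le (l - of_real k s)) h => {h}.
rewrite real_valueB of_realK; move: (real_value l) => r.
rewrite ltr_norml => /andP[h _]; lra.
Qed.

End RealNorm.

(** * Bounded operators and total families *)

Section Operators.
Variables (R : realType) (k : scalar_kind).
Local Notation K := (scalars R k).
Variable H : completeNormedModType K.
Implicit Types (x y z : H) (T S : {linear H -> H}).

Lemma bounded_operatorP (T : H -> H) :
  bounded_operator T <->
  exists2 M : R, 0 < M & forall x, nm (T x) <= M * nm x.
Proof.
split=> [[M hM]|[M M0 hM]]; last first.
  exists (of_real k M) => x.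
  by rewrite -!of_real_nm -of_realM of_real_le.
exists (nm (M : K) + 1) => [|x]; first by rewrite ltr_wpDl// nm_ge0.
apply: (@le_trans _ _ (nm (M : K) * nm x)); last first.
  by rewrite ler_wpM2r ?nm_ge0// lerDl.
rewrite -(of_real_le k) of_realM !of_real_nm.
have h := hM x; apply: (le_trans h).
by rewrite -[leLHS]ger0_norm ?normrM ?normr_id// (le_trans _ h).
Qed.

Lemma linear_bundle (F : H -> H) :
  (forall (a : K) u v, F (a *: u + v) = a *: F u + F v) ->
  exists L : {linear H -> H}, L =1 F.
Proof.
move=> linF; pose m := GRing.isLinear.Build K H H *:%R F linF.
pose L : {linear H -> H} := HB.pack F m.
by exists L.
Qed.

(** The zero set of a bounded functional is a closed subspace. *)
Lemma total_vanish (A : set nat) (f : nat -> H) (phi : H -> K) (M : R) :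
  (forall (a : K) u v, phi (a *: u + v) = a * phi u + phi v) ->
  (forall x, nm (phi x : K) <= M * nm x) ->
  total_family A f -> (forall i, A i -> phi (f i) = 0) ->
  forall x, phi x = 0.
Proof.
move=> lin bnd tot van x.
have phi0 : phi 0 = 0.
  by apply: nm_eq0; apply: le_anti; rewrite nm_ge0 (le_trans (bnd 0))// nm0 mulr0.
have span0 y : finite_span A f y -> phi y = 0.
  case=> n [c ->]; elim/big_rec: _ => // i z iA ih.
  by rewrite lin ih van ?mulr0 ?addr0//; exact: set_mem.
have M0 : 0 <= `|M| + 1 by rewrite addr_ge0.
apply: nm_eq0; apply: le_anti; rewrite nm_ge0 andbT.
apply/ler_addgt0Pr => e e0; rewrite add0r.
have : closure (finite_span A f) x by rewrite tot.
have d0 : 0 < e / (`|M| + 1) by rewrite divr_gt0// ltr_wpDl.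
move=> /closure_nmP/(_ _ d0)[y Ay xy].
have -> : phi x = phi (x - y).
  by rewrite -[x in LHS](subrK y) -[x - y in LHS]scale1r lin mul1r (span0 _ Ay) addr0.
apply: le_trans (bnd _) _.
apply: (@le_trans _ _ ((`|M| + 1) * nm (x - y))).
  by apply: ler_wpM2r; rewrite ?nm_ge0//; have := ler_norm M; lra.
by rewrite mulrC -ler_pdivlMr ?ltW// ltr_wpDl.
Qed.

(** The lower bound makes [T] injective, so that the preimages form a linear map,
    and it bounds this map by [c^-1]. *)
Lemma bounded_below_inverse (T : {linear H -> H}) (c : R) : 0 < c ->
  (forall x, c * nm x <= nm (T x)) -> (forall y, exists x, T x = y) ->
  exists S : {linear H -> H}, [/\ bounded_operator S, cancel T S & cancel S T].
Proof.
move=> c0 low sur.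
have [F FK] : {F : H -> H | forall y, T (F y) = y}.
  by exists (fun y => projT1 (cid (sur y))) => y; case: cid.
have inj x : T x = 0 -> x = 0.
  move=> Tx; apply: nm_eq0; apply: le_anti; rewrite nm_ge0 andbT.
  by have := low x; rewrite Tx nm0 pmulr_rle0.
have injT : injective T.
  by move=> x y xy; apply/eqP; rewrite -subr_eq0; apply/eqP/inj;
    rewrite linearB xy subrr.
have [S SE] : exists S : {linear H -> H}, S =1 F.
  by apply: linear_bundle => a u v; apply: injT; rewrite linearP !FK.
exists S; split=> [|x|y]; last by rewrite SE FK.
  apply/bounded_operatorP; exists c^-1 => [|x]; first by rewrite invr_gt0.
  by rewrite ler_pdivlMl// (le_trans (low _))// SE FK.
by apply: injT; rewrite SE FK.
Qed.

(** The solution of [x - D x = y] is the sum of the Neumann series of [D]. *)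
Lemma neumann (D : {linear H -> H}) (y : H) :
  (forall x, nm (D x) <= 2^-1 * nm x) -> exists x, x - D x = y.
Proof.
move=> half; pose u n := iter n (fun x => y + D x) 0.
have step n : nm (u n.+1 - u n) <= 2^-1 ^+ n * nm y.
  elim: n => [|n ih]; first by rewrite /u/= linear0 addr0 subr0 expr0 mul1r.
  rewrite [u n.+2]/(y + D (u n.+1)) [u n.+1]/(y + D (u n)).
  rewrite opprD addrACA subrr add0r -linearB.
  by apply: le_trans (half _) _; rewrite exprS -mulrA ler_wpM2l.
have tail N n : nm (u (N + n)%N - u N) <= 2 * 2^-1 ^+ N * nm y - 2 * 2^-1 ^+ (N + n) * nm y.
  elim: n => [|n ih]; first by rewrite addn0 !subrr nm0.
  rewrite addnS; have := nmD (u (N + n).+1 - u (N + n)%N) (u (N + n)%N - u N).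
  rewrite addrA subrK; have := step (N + n)%N; rewrite exprS.
  set p := 2^-1 ^+ (N + n); set q := 2^-1 ^+ N in ih *; move: ih.
  rewrite -/p; set a := nm _; set b := nm _; set d := nm _; lra.
have cv : cvgn u.
  apply: cauchy_nm_cvgn => e e0.
  have : (fun n => 2^-1 ^+ n : R) @ \oo --> (0 : R).
    by apply: cvg_expr; rewrite ger0_norm ?invf_lt1// ltr1n.
  move=> /cvgrPdist_lt/(_ (e / (2 * (nm y + 1)))).
  have ny : 0 < nm y + 1 by rewrite ltr_wpDl// nm_ge0.
  case=> [|N _ /(_ N (leqnn N))/=]; first by rewrite divr_gt0// mulr_gt0.
  rewrite sub0r normrN ger0_norm ?exprn_ge0// ltr_pdivlMr ?mulr_gt0// => hN.
  exists N => n Nn; rewrite nm_distC -(subnKC Nn); apply: le_lt_trans (tail _ _) _.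
  have : 0 <= 2^-1 ^+ (N + (n - N)) * nm y by rewrite mulr_ge0 ?nm_ge0.
  have : 0 <= 2^-1 ^+ N :> R by rewrite exprn_ge0.
  move: hN; set p := 2^-1 ^+ N; set q := 2^-1 ^+ _; nra.
exists (limn u); apply/eqP; rewrite subr_eq -subr_eq0; apply/eqP.
apply: nm_eq0; apply: le_anti; rewrite nm_ge0 andbT.
apply/ler_addgt0Pr => e e0; rewrite add0r.
have /cvg_nmP/(_ (e / 2))[|N hN] := cv; first by rewrite divr_gt0.
have := hN _ (leqnn N); have := hN _ (leqnSn N).
have -> : limn u - (y + D (limn u)) = (limn u - u N.+1) - D (limn u - u N).
  by rewrite [u N.+1]/(y + D (u N)) linearB opprB addrA !opprD !addrA addrNK.
have := nmB (limn u - u N.+1) (D (limn u - u N)).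
have := half (limn u - u N); have := nm_ge0 (limn u - u N); lra.
Qed.
End Operators.

(** * Inner products and orthonormal families *)

Section InnerProduct.
Variables (R : realType) (k : scalar_kind).
Local Notation K := (scalars R k).
Variables (H : completeNormedModType K) (ip : {dot H for @scalar_conj R k}).
Hypothesis ip_norm : forall x : H, `|x| ^+ 2 = ip x x.
Implicit Types (x y z : H) (A : set nat) (e f : nat -> H).

Lemma ipC x y : ip x y = scalar_conj (ip y x).
Proof. by have := hermitian_subproof x y => ->; rewrite expr0 mul1r. Qed.

Lemma ipZl (a : K) x y : ip (a *: x) y = a * ip x y.
Proof. exact: linearZl_LR. Qed.

Lemma ipZr (a : K) x y : ip x (a *: y) = scalar_conj a * ip x y.
Proof. exact: linearZr_LR. Qed.

Lemma ip_suml (I : Type) (r : seq I) (P : pred I) (F : I -> H) y :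
  ip (\sum_(i <- r | P i) F i) y = \sum_(i <- r | P i) ip (F i) y.
Proof. exact: (big_morph (ip^~ y) (linearDl ip y) (linear0l ip y)). Qed.

Lemma ip_sumr (I : Type) (r : seq I) (P : pred I) (F : I -> H) y :
  ip y (\sum_(i <- r | P i) F i) = \sum_(i <- r | P i) ip y (F i).
Proof. exact: linear_sumr. Qed.

Lemma nm2_ip x : nm x ^+ 2 = real_value (ip x x).
Proof. by rewrite -ip_norm nm_sqr of_realK. Qed.

Lemma ip_sym0 x y : ip x y = 0 -> ip y x = 0.
Proof. by move=> xy; rewrite ipC xy conj0. Qed.

Lemma pythagoras x y : ip x y = 0 -> nm (x + y) ^+ 2 = nm x ^+ 2 + nm y ^+ 2.
Proof.
move=> xy; rewrite !nm2_ip linearDl !linearDr/= xy (ip_sym0 xy).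
by rewrite !(addr0, add0r) real_valueD.
Qed.

Lemma cauchy_schwarz x y : nm (ip x y : K) <= nm x * nm y.
Proof.
have [y0|y0] := eqVneq (nm y) 0.
  by rewrite (nm_eq0 y0) linear0r nm0 nm0 mulr0.
have yy : ip y y != 0.
  rewrite -ip_norm sqrf_eq0 normr_eq0.
  by apply: contraNneq y0 => ->; rewrite nm0.
have ypos : 0 < nm y by rewrite lt_neqAle eq_sym y0 nm_ge0.
(* The orthogonal projection of [x] on the line of [y] *)
pose p := (ip x y / ip y y) *: y.
have orth : ip (x - p) p = 0.
  by rewrite /p ipZr linearBl/= ipZl divfK// subrr mulr0.
have := pythagoras orth; rewrite subrK => xp.
have : nm p ^+ 2 <= nm x ^+ 2 by rewrite xp lerDr sqr_ge0.
rewrite ler_pXn2r// ?nnegrE ?nm_ge0// => px.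
have : nm p * nm y = nm (ip x y : K).
  rewrite nmZ -nm_scalar -mulrA -expr2; apply: (@of_real_inj R k).
  rewrite of_realM -nm_sqr ip_norm !of_real_nm.
  have yy_ge0 : 0 <= ip y y by rewrite -ip_norm exprn_ge0.
  by rewrite -[X in _ * X = _](ger0_norm yy_ge0) -normrM divfK.
by move=> <-; rewrite ler_wpM2r ?nm_ge0.
Qed.

Section Orthonormal.
Variables (A : set nat) (e : nat -> H).
Hypothesis eON : forall i j, A i -> A j -> ip (e i) (e j) = (i == j)%:R.

Lemma ip_sum_orthonormal (P : pred nat) m n (c : nat -> K) j : A j ->
  (forall i, P i -> A i) ->
  ip (\sum_(m <= i < n | P i) c i *: e i) (e j) =
  if (m <= j < n)%N && P j then c j else 0.
Proof.
move=> Aj PA; rewrite ip_suml (eq_bigr (fun i => if i == j then c i else 0)).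
  rewrite big_mkcond /=; case: ifP => [/andP[mjn Pj]|H0].
    rewrite (bigD1_seq j)/= ?mem_index_iota ?iota_uniq// Pj eqxx.
    by rewrite big1 ?addr0// => i /negbTE ->; rewrite if_same.
  rewrite big_nat_cond big1// => i /andP[mn _]; case: ifP => // Pi.
  by case: eqP => // ij; rewrite -ij mn Pi in H0.
move=> i Pi; rewrite ipZl eON//; last exact: PA.
by case: eqP => _; rewrite ?mulr1 ?mulr0.
Qed.

Lemma nm2_sum_orthonormal (P : pred nat) m n (c : nat -> K) :
  (forall i, P i -> A i) ->
  nm (\sum_(m <= i < n | P i) c i *: e i) ^+ 2 =
  \sum_(m <= i < n | P i) nm (c i) ^+ 2.
Proof.
move=> PA; rewrite nm2_ip {2}[\sum_(m <= i < n | P i) c i *: e i]big_nat_cond.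
rewrite ip_sumr real_value_sum [RHS]big_nat_cond; apply: eq_bigr => j jP.
rewrite ipZr ip_sum_orthonormal ?jP//; last by apply: PA; case/andP: jP.
by rewrite mulrC mul_conj nm_sqr of_realK.
Qed.

Lemma bessel (P : pred nat) m n x : (forall i, P i -> A i) ->
  \sum_(m <= i < n | P i) nm (ip x (e i) : K) ^+ 2 <= nm x ^+ 2.
Proof.
move=> PA; set p := \sum_(m <= i < n | P i) ip x (e i) *: e i.
have orth : ip (x - p) p = 0.
  rewrite {2}/p big_nat_cond ip_sumr big1// => j jP; have /andP[mjn Pj] := jP.
  rewrite ipZr linearBl/= /p ip_sum_orthonormal ?mjn ?Pj ?subrr ?mulr0//.
  exact: PA.
have := pythagoras orth; rewrite subrK => ->.
by rewrite nm2_sum_orthonormal// lerDr sqr_ge0.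
Qed.

End Orthonormal.

(** * Perturbations of an invertible operator *)

Lemma inverse_lower_bound (T S : {linear H -> H}) (M : R) :
  cancel T S -> (forall x, nm (S x) <= M * nm x) ->
  forall x, nm x <= M * nm (T x).
Proof. by move=> TS SM x; rewrite -{1}(TS x). Qed.

(** [T - D] is [T \o (1 - S \o D)], where [S \o D] has norm at most one half. *)
Lemma small_perturbation_invertible (T S D : {linear H -> H}) (M : R) :
  0 < M -> bounded_operator T -> (forall x, nm (S x) <= M * nm x) ->
  cancel T S -> cancel S T -> (forall x, nm (D x) <= (2 * M)^-1 * nm x) ->
  exists T' S' : {linear H -> H},
    [/\ bounded_operator T', bounded_operator S', cancel T' S', cancel S' T' &
        forall x, T' x = T x - D x].
Proof.
move=> M0 Tb SM TS ST Ds.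
have [T' T'E] : exists T' : {linear H -> H}, T' =1 (fun x => T x - D x).
  apply: linear_bundle => a u v.
  by rewrite (linearP T) (linearP D) opprD addrACA scalerBr.
have low x : (2 * M)^-1 * nm x <= nm (T' x).
  have := inverse_lower_bound TS SM x; rewrite T'E => h1.
  have h2 := Ds x; have h3 := le_nmB (T x) (D x).
  have : M^-1 * nm x <= nm (T x) by rewrite ler_pdivrMl.
  by move: h2; rewrite invfM; lra.
have sur y : exists x, T' x = y.
  have [SD SDE] : exists L : {linear H -> H}, L =1 (fun x => S (D x)).
    by apply: linear_bundle => a u v; rewrite (linearP D) (linearP S).
  have [x|x hx] := @neumann _ _ _ SD (S y).
    rewrite SDE; apply: le_trans (SM _) _.
    have := Ds x; rewrite invfM -mulrA => h.
    by rewrite -ler_pdivlMl// mulrCA.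
  by exists x; rewrite T'E -[y]ST -hx SDE linearB ST.
have c0 : 0 < (2 * M)^-1 by rewrite invr_gt0 mulr_gt0.
have [S' [S'b T'S' S'T']] := bounded_below_inverse c0 low sur.
exists T', S'; split=> //.
have [N N0 TN] := (bounded_operatorP T).1 Tb.
apply/bounded_operatorP; exists (N + (2 * M)^-1); first by rewrite addr_gt0.
by move=> x; rewrite T'E mulrDl (le_trans (nmB _ _))// lerD.
Qed.

(** The new operator sends [u] to [v] and agrees with [T] on the vectors
    orthogonal to [u]. It is [T \o (1 + <-, u> w)] with [w = S v - u]; the
    rank-one perturbation of the identity is inverted by the Sherman-Morrison
    formula, whose denominator [1 + <w, u>] is [<S v, u>]. *)
Lemma replace_invertible (T S : {linear H -> H}) (u v : H) :
  bounded_operator T -> bounded_operator S -> cancel T S -> cancel S T ->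
  ip u u = 1 -> ip (S v) u != 0 ->
  exists T' S' : {linear H -> H},
    [/\ bounded_operator T', bounded_operator S', cancel T' S', cancel S' T' &
        (forall x, T' x = T x + ip x u *: (v - T u))].
Proof.
move=> Tb Sb TS ST uu al0; set al := ip (S v) u in al0 *.
have [T' T'E] : exists T' : {linear H -> H},
    T' =1 (fun x => T x + ip x u *: (v - T u)).
  apply: linear_bundle => a x y; rewrite (linearP T) linearDl/= ipZl.
  by move: (v - T u) => w; rewrite scalerDl scalerDr addrACA scalerA.
have [S' S'E] : exists S' : {linear H -> H},
    S' =1 (fun y => S y - (ip (S y) u / al) *: (S v - u)).
  apply: linear_bundle => a x y; rewrite (linearP S) linearDl/= ipZl.
  by move: (S v - u) => w; rewrite mulrDl scalerDl opprD scalerBr addrACA scalerA mulrA.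
have bnd (L M : {linear H -> H}) (w : H) (F : H -> H) :
    bounded_operator L -> bounded_operator M ->
    (forall x, F x = L x + ip (M x) u *: w) -> bounded_operator F.
  move=> /bounded_operatorP[a a0 La] /bounded_operatorP[b b0 Mb] FE.
  apply/bounded_operatorP; exists (a + b * nm u * nm w).
    by rewrite ltr_wpDr// !mulr_ge0 ?nm_ge0// ltW.
  move=> x; rewrite FE (le_trans (nmD _ _))// mulrDl lerD// nmZ -nm_scalar.
  rewrite mulrAC ler_wpM2r ?nm_ge0//; apply: le_trans (cauchy_schwarz _ _) _.
  by rewrite mulrAC ler_wpM2r ?nm_ge0.
exists T', S'; split=> //.
- apply: (bnd T idfun (v - T u)) => //; apply/bounded_operatorP.
  by exists 1 => // x; rewrite mul1r.
- apply: (bnd S S (- (al^-1 *: (S v - u)))) => // x.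
  by rewrite S'E scalerN scalerA.
- move=> x; rewrite S'E T'E linearD linearZ/= TS linearB TS.
  rewrite linearDl/= ipZl linearBl/= uu -/al.
  have -> : (ip x u + ip x u * (al - 1)) / al = ip x u.
    by rewrite -[X in X + _]mulr1 -mulrDr addrC subrK mulfK.
  by rewrite addrK.
- move=> y; rewrite T'E S'E linearB linearZ/= linearB !ST.
  rewrite linearBl/= ipZl linearBl/= uu -/al.
  have -> : ip (S y) u - ip (S y) u / al * (al - 1) = ip (S y) u / al.
    by rewrite mulrBr mulr1 divfK// opprB addrC subrK.
  by rewrite subrK.
Qed.

End InnerProduct.

(** * Compact synthesis operators *)

Section CompactSynthesis.
Variables (R : realType) (k : scalar_kind).
Local Notation K := (scalars R k).

Lemma series_stationary (V : normedModType K) (F : nat -> V) n :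
  (forall i, (n <= i)%N -> F i = 0) ->
  series F @ \oo --> \sum_(0 <= i < n) F i.
Proof.
move=> F0; apply/cvg_nmP => e e0; exists n => m nm_.
rewrite seriesEnat /= (big_cat_nat (leq0n n) nm_)/=.
have -> : \sum_(n <= i < m) F i = 0.
  by rewrite big_nat_cond big1// => i /andP[/andP[/F0]].
by rewrite addr0 subrr nm0.
Qed.

Variable H : completeNormedModType K.
Implicit Types (h : nat -> H) (c : nat -> K).

(** An operator norm bound for the synthesis operator of [h] on a finite block of
    coefficients, squared in order to avoid roots of sums of squares. *)
Definition block_bound h (B : R) m n := forall c,
  nm (\sum_(m <= i < n) c i *: h i) ^+ 2 <=
  B ^+ 2 * \sum_(m <= i < n) nm (c i) ^+ 2.

Lemma block_bound_unit h B m n : 0 <= B ->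
  (forall c, \sum_(m <= i < n) nm (c i) ^+ 2 <= 1 ->
     nm (\sum_(m <= i < n) c i *: h i) <= B) ->
  block_bound h B m n.
Proof.
move=> B0 unit c; set s := \sum_(m <= i < n) nm (c i) ^+ 2.
have s0 : 0 <= s by apply: sumr_ge0 => i _; rewrite sqr_ge0.
apply/ler_addgt0Pr => e e0; have d0 : 0 < e / (B ^+ 2 + 1).
  by rewrite divr_gt0// ltr_wpDl// sqr_ge0.
(* The extra [d] keeps the scaling factor finite when all coefficients vanish. *)
set d := e / _ in d0; pose r := Num.sqrt (s + d).
have sd : 0 < s + d by rewrite ltr_wpDl.
have r0 : 0 < r by rewrite sqrtr_gt0.
have r2 : r ^+ 2 = s + d by rewrite sqr_sqrtr// ltW.
have nr : nm (of_real k r^-1 : K) = r^-1 by rewrite nm_of_real gtr0_norm ?invr_gt0.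
have := unit (fun i => of_real k r^-1 * c i).
under eq_bigr do rewrite nmM nr exprMn.
rewrite -mulr_sumr -/s exprVn r2 ler_pdivrMl// mulr1 lerDl => /(_ (ltW d0)).
under eq_bigr do rewrite -scalerA.
rewrite -scaler_sumr nmZ -nm_scalar nr ler_pdivrMl// => h1.
apply: (@le_trans _ _ (B ^+ 2 * (s + d))).
  rewrite -r2 -exprMn [B * r]mulrC; apply: lerXn2r h1; rewrite nnegrE.
    exact: nm_ge0.
  by rewrite mulr_ge0// ltW.
rewrite mulrDr lerD2l /d mulrA ler_pdivrMr ?ltr_wpDl ?sqr_ge0//.
by rewrite mulrC ler_wpM2l ?(ltW e0)// lerDl.
Qed.

Lemma finite_in_unit_image h m n c :
  \sum_(m <= i < n) nm (c i) ^+ 2 <= 1 ->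
  (synthesis h @` @l2_unit_ball K) (\sum_(m <= i < n) c i *: h i).
Proof.
move=> c1; have [nm_|mn] := leqP n m.
  exists (fun=> 0); last first.
    rewrite /synthesis big_geq//; apply: cvg_lim => //.
    under eq_fun do rewrite scale0r.
    have := @series_stationary H (fun=> 0) 0 (fun _ _ => erefl).
    by rewrite big_geq.
  rewrite /l2_unit_ball /l2 /=.
  under eq_fun do rewrite normr0 expr0n/=.
  have := @series_stationary K^o (fun=> 0) 0 (fun _ _ => erefl).
  rewrite big_geq// => cv; split; first by apply/cvg_ex; exists 0.
  by rewrite (cvg_lim _ cv)// ler01.
pose c' i := if (m <= i < n)%N then c i else 0.
have out i : (n <= i)%N -> c' i = 0.
  by move=> ni; rewrite /c' ltnNge ni andbF.
have sumE (V : nmodType) (F G : nat -> V) : (forall i, (m <= i < n)%N -> F i = G i) ->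
    (forall i, ~~ (m <= i < n)%N -> F i = 0) ->
    \sum_(0 <= i < n) F i = \sum_(m <= i < n) G i.
  move=> FG F0; rewrite (big_cat_nat (leq0n m) (ltnW mn))/=.
  rewrite big_nat_cond big1 ?add0r; last first.
    by move=> i /andP[/andP[_ im] _]; apply: F0; rewrite leqNgt im.
  by apply: eq_big_nat => i mi; apply: FG.
exists c'.
  have cv := @series_stationary K^o (fun i => `|c' i| ^+ 2) n.
  have /cv {}cv : forall i, (n <= i)%N -> `|c' i| ^+ 2 = 0.
    by move=> i /out ->; rewrite normr0 expr0n.
  split; first by apply/cvg_ex; eexists; exact: cv.
  rewrite (cvg_lim _ cv)// (sumE _ _ (fun i => `|c i| ^+ 2)).
  - under eq_bigr do rewrite nm_sqr.
    by rewrite -of_real_sum -(of_real1 R k) of_real_le.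
  - by move=> i mi; rewrite /c' mi.
  - by move=> i mi; rewrite /c' (negbTE mi) normr0 expr0n.
have cv := @series_stationary H (fun i => c' i *: h i) n.
have /cv {}cv : forall i, (n <= i)%N -> c' i *: h i = 0.
  by move=> i /out ->; rewrite scale0r.
rewrite /synthesis (cvg_lim _ cv)//; apply: sumE => i mi; rewrite /c' ?mi//.
by rewrite (negbTE mi) scale0r.
Qed.

Lemma precompact_cluster (S : set H) (y : nat -> H) :
  precompact S -> (forall n, S (y n)) ->
  exists p, forall e : R, 0 < e -> forall N, exists2 n, (N <= n)%N & nm (y n - p) < e.
Proof.
rewrite precompactE => cS Sy.
have [p [_ clp]] : closure S `&` cluster (y @ \oo) !=set0.
  apply: cS; exists 0%N => // n _ /=; exact: subset_closure.
exists p => e e0 N.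
have e0' : 0 < of_real k e by rewrite -[0](of_real0 R k) of_real_lt.
have : (y @ \oo) [set y n | n in [set n | (N <= n)%N]].
  by exists N => // n /= Nn; exists n.
move=> /clp/(_ (nbhsx_ballx p _ e0'))[_ [[n Nn <-]]].
rewrite -ball_normE /ball_ /= -of_real_nm of_real_lt nm_distC => ?.
by exists n.
Qed.

Lemma compact_block_bound h : synthesis_compact h ->
  exists2 M : R, 0 < M & forall m n, block_bound h M m n.
Proof.
move=> hc; apply: contrapT => /forall2NP nb.
have y_ex j : exists y, (synthesis h @` @l2_unit_ball K) y /\ j%:R < nm y.
  apply: contrapT => /forallNP small.
  have [|] := nb (j.+1%:R); first by apply.
  apply=> m n; apply: block_bound_unit => // c c1.
  have := small (\sum_(m <= i < n) c i *: h i) => /not_andP[|/negP].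
    by case; exact: finite_in_unit_image.
  by rewrite -leNgt => /le_trans; apply; rewrite ler_nat.
have [y yP] := choice y_ex.
have [p pP] := precompact_cluster hc (fun n => (yP n).1).
have [n Nn ynp] := pP _ ltr01 (Num.truncn (nm p + 1)).+1.
have := (yP n).2; have := le_nmB (y n) p.
have : nm p + 1 < n%:R.
  apply: lt_le_trans (truncnS_gt _) _; by rewrite ler_nat.
lra.
Qed.

(** Unit coefficient vectors supported arbitrarily far out cannot have images of
    norm more than [d]: the images would accumulate at some [p] with
    [d / 2 < nm p], and the sum of [L] disjoint blocks whose images are close to
    [p] has norm at most the square root of [L] while its image has norm of
    order [L]. *)
Lemma compact_tail_bound h (d : R) : synthesis_compact h -> 0 < d ->
  exists N, forall m n, (N <= m)%N -> block_bound h d m n.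
Proof.
move=> hc d0; apply: contrapT => /forallNP nb.
have [M M0 hM] := compact_block_bound hc.
have blk N : exists b : nat * nat * (nat -> K), [/\ (N <= b.1.1)%N,
    \sum_(b.1.1 <= i < b.1.2) nm (b.2 i) ^+ 2 <= 1 &
    d < nm (\sum_(b.1.1 <= i < b.1.2) b.2 i *: h i)].
  apply: contrapT => /forallNP small; apply: (nb N) => m n Nm.
  apply: block_bound_unit; first exact: ltW.
  move=> c c1; rewrite leNgt; apply/negP => dn; apply: (small (m, n, c)).
  by split.
have [b bP] := choice blk.
pose y N := \sum_((b N).1.1 <= i < (b N).1.2) (b N).2 i *: h i.
have [|p pP] := @precompact_cluster _ y hc.
  by move=> N; apply: finite_in_unit_image; case: (bP N).
have d4 : 0 < d / 4 by rewrite divr_gt0.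
have p2 : d / 2 < nm p.
  have [n _ hn] := pP _ d4 0%N; have [_ _] := bP n; rewrite -/(y n).
  have := le_nmB (y n) p; lra.
(* Far blocks whose images are close to [p] are appended one after another. *)
have many L : exists N c, \sum_(0 <= i < N) nm (c i) ^+ 2 <= L%:R /\
    nm (\sum_(0 <= i < N) c i *: h i - L%:R *: p) <= L%:R * (d / 4).
  elim: L => [|L [N [c [c1 c2]]]].
    exists 0%N, (fun=> 0); rewrite !big_geq// scale0r subrr nm0 mul0r.
    by split.
  have [N' NN' close] := pP _ d4 N; have [N'm] := bP N'.
  move: close; rewrite /y; case: (b N') N'm => [[m n] c'] /= N'm.
  have Nm : (N <= m)%N := leq_trans NN' N'm.
  set z := \sum_(_ <= i < _) _ => close c'1 _.
  have [mn|nm_] := leqP m n; last first.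
    rewrite /z big_geq ?(ltnW nm_)// sub0r nmN in close; lra.
  pose c'' i := if (i < N)%N then c i else if (i < m)%N then 0 else c' i.
  have split_sum (V : nmodType) (F : nat -> K -> V) : (forall i, F i 0 = 0) ->
      \sum_(0 <= i < n) F i (c'' i) =
      \sum_(0 <= i < N) F i (c i) + \sum_(m <= i < n) F i (c' i).
    move=> F0; rewrite (big_cat_nat (leq0n N) (leq_trans Nm mn))/=.
    rewrite (big_cat_nat Nm mn)/= [X in _ + (X + _)]big_nat_cond.
    rewrite [X in _ + (X + _)]big1 ?add0r => [|i /andP[/andP[Ni im] _]].
      congr (_ + _); apply: eq_big_nat => i /andP[i1 i2]; rewrite /c'' ?i2//.
      by rewrite !ltnNge (leq_trans Nm i1) i1.
    by rewrite /c'' ltnNge Ni/= im F0.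
  exists n, c''; split.
    rewrite (split_sum _ (fun _ a => nm a ^+ 2)); last first.
      by move=> _; rewrite nm0 expr0n.
    by rewrite -natr1 lerD.
  rewrite (split_sum _ (fun i a => a *: h i)); last by move=> i; rewrite scale0r.
  rewrite -/z -natr1 scalerDl scale1r opprD addrACA -[L.+1%:R]natr1 mulrDl mul1r.
  by apply: le_trans (nmD _ _) _; apply: lerD => //; exact: ltW.
(* [L] blocks give [L * (d / 4) <= M * sqrt L], which fails for large [L]. *)
pose L := (Num.truncn (16 * M ^+ 2 / d ^+ 2)).+1.
have [N [c [c1 c2]]] := many L.
have L0 : 0 < L%:R :> R by rewrite ltr0n.
have hL : 16 * M ^+ 2 / d ^+ 2 < L%:R := truncnS_gt _.
have := hM 0%N N c; set z := \sum_(0 <= i < N) c i *: h i in c2 *.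
have : L%:R * (d / 4) <= nm z.
  have := le_nmB (L%:R *: p) z; rewrite [nm (_ - z)]nm_distC nmZ -nm_scalar.
  have -> : nm (L%:R : K) = L%:R.
    rewrite -[RHS]ger0_norm ?ler0n// -(nm_of_real k); congr nm.
    by elim: (L) => [|j ih]; rewrite ?of_real0// -!natr1 of_realD of_real1 ih.
  nra.
rewrite ltr_pdivrMr ?exprn_gt0// in hL.
set s := \sum_(0 <= i < N) _ in c1 *; move: (nm z) => w lw wM.
have : (L%:R * (d / 4)) ^+ 2 <= M ^+ 2 * L%:R.
  apply: (@le_trans _ _ (w ^+ 2)).
    by apply: lerXn2r => //; rewrite nnegrE ?mulr_ge0// ?(le_trans _ lw)// ?mulr_ge0// ltW.
  by apply: (le_trans wM); rewrite ler_wpM2l// sqr_ge0.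
have -> : (L%:R * (d / 4)) ^+ 2 = L%:R * (L%:R * d ^+ 2 / 16) by field.
by rewrite mulrC ler_pM2r// leNgt => /negP; apply; rewrite ltr_pdivlMr// mulrC.
Qed.
End CompactSynthesis.

(** * Compact perturbations of a Riesz basis *)

Section Perturbation.
Variables (R : realType) (k : scalar_kind).
Local Notation K := (scalars R k).
Variables (H : completeNormedModType K) (ip : {dot H for @scalar_conj R k}).
Hypothesis ip_norm : forall x : H, `|x| ^+ 2 = ip x x.
Variables (A : set nat) (e : nat -> H).
Hypothesis eON : forall i j, A i -> A j -> ip (e i) (e j) = (i == j)%:R.

(** Setting the coefficients to zero outside [A] turns series over [A] into
    ordinary series. *)
Definition coefficient (x : H) i : K := if i \in A then ip x (e i) else 0.

Lemma sum_coefficient m n x :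
  \sum_(m <= i < n) nm (coefficient x i) ^+ 2 <= nm x ^+ 2.
Proof.
have := @bessel _ _ _ _ ip_norm _ _ eON (mem A) m n x (fun i => set_mem).
rewrite big_mkcond/=; under eq_bigr => i _.
  rewrite (_ : (if _ then _ else _) = nm (coefficient x i) ^+ 2); first over.
  by rewrite /coefficient; case: ifP; rewrite ?nm0 ?expr0n.
by [].
Qed.

Lemma block_bound_cvgn (h : nat -> H) (B : R) x :
  (forall m n, block_bound h B m n) ->
  cvgn (series (fun i => coefficient x i *: h i)).
Proof.
move=> hB; apply: cauchy_nm_cvgn => d d0.
pose b i := nm (coefficient x i) ^+ 2.
have b0 i : 0 <= b i by rewrite sqr_ge0.
have [s cs [sb _]] := @nonneg_series_cvgn R k b _ b0 (fun n => sum_coefficient 0 n x).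
have B1 : 0 < B ^+ 2 + 1 by rewrite ltr_wpDl// sqr_ge0.
have dB : 0 < d ^+ 2 / (B ^+ 2 + 1) by rewrite divr_gt0// exprn_gt0.
have /cvg_nmP/(_ _ dB)[N /(_ _ (leqnn N))] := cs.
rewrite seriesEnat/= -of_real_sum.
have -> (u v : R) : (of_real k u : K) - of_real k v = of_real k (u - v).
  by apply/eqP; rewrite subr_eq -of_realD subrK.
rewrite nm_of_real => sN; exists N => n Nn.
rewrite nm_distC !seriesEnat/= (big_cat_nat (leq0n N) Nn)/= [X in nm (X - _)]addrC addrK.
rewrite -(@ltr_pXn2r _ 2)// ?nnegrE ?nm_ge0 ?(ltW d0)//.
apply: le_lt_trans (hB N n _) _.
have : \sum_(N <= i < n) b i <= s - \sum_(0 <= i < N) b i.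
  by have := sb n; rewrite (big_cat_nat (leq0n N) Nn)/= lerBrDl.
move=> /le_trans/(_ (ler_norm _)) h1.
have := le_lt_trans h1 sN; rewrite ltr_pdivlMr// => h2.
have : 0 <= \sum_(N <= i < n) b i by apply: sumr_ge0.
rewrite /b in h2 *; move: (\sum_(N <= i < n) _) h2 => t; lra.
Qed.

(** The operator sending [e i] to [h i]; its series converges because the blocks
    of [h] are controlled by the blocks of the square-summable coefficients. *)
Lemma block_bound_operator (h : nat -> H) (B : R) : 0 <= B ->
  (forall m n, block_bound h B m n) ->
  exists2 D : {linear H -> H}, forall x, nm (D x) <= B * nm x &
    forall i, A i -> D (e i) = h i.
Proof.
move=> B0 hB; pose u x := series (fun i => coefficient x i *: h i).
have cv x : u x @ \oo --> limn (u x) by exact: block_bound_cvgn.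
have [D DE] : exists D : {linear H -> H}, D =1 (fun x => limn (u x)).
  apply: linear_bundle => a x y; apply: cvg_lim => //.
  have -> : u (a *: x + y) = (fun n => a *: u x n + u y n).
    apply/funext => n; rewrite /u !seriesEnat/= scaler_sumr -big_split/=.
    apply: eq_bigr => i _; rewrite scalerA -scalerDl; congr (_ *: _).
    rewrite /coefficient; case: ifP => _; last by rewrite mulr0 addr0.
    by rewrite linearDl/= ipZl.
  by apply: cvgD => //; apply: cvgZr.
exists D => [x|i Ai]; rewrite DE.
  apply: (nm_lim_le (cv x)) => n.
  rewrite -(@ler_pXn2r _ 2)// ?nnegrE ?mulr_ge0 ?nm_ge0//.
  rewrite /u seriesEnat; apply: le_trans (hB _ _ _) _.
  by rewrite exprMn ler_wpM2l ?sqr_ge0// sum_coefficient.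
apply: cvg_lim => //.
have coE j : coefficient (e i) j = (i == j)%:R.
  rewrite /coefficient; case: ifPn => [/set_mem Aj|]; first exact: eON.
  by case: eqP => // <-; rewrite mem_set.
have cvi := @series_stationary _ _ H (fun j => coefficient (e i) j *: h j) i.+1.
have /cvi {}cvi : forall j, (i.+1 <= j)%N -> coefficient (e i) j *: h j = 0.
  by move=> j ij; rewrite coE ltn_eqF// scale0r.
rewrite big_nat_recr//= coE eqxx scale1r big_nat_cond big1 ?add0r in cvi => //.
by move=> j /andP[/andP[_ ji] _]; rewrite coE gtn_eqF// scale0r.
Qed.

(** Only the tail of [h] is subtracted, and tails of a compact synthesis operator
    are small. *)
Lemma tail_perturbation (T S : {linear H -> H}) (f h : nat -> H) :
  bounded_operator T -> bounded_operator S -> cancel T S -> cancel S T ->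
  (forall i, A i -> f i = T (e i)) -> synthesis_compact h ->
  exists N (T' S' : {linear H -> H}),
    [/\ bounded_operator T', bounded_operator S', cancel T' S', cancel S' T' &
      forall i, A i -> T' (e i) = if (i < N)%N then f i else f i - h i].
Proof.
move=> Tb Sb TS ST fE hc; have [M M0 SM] := (bounded_operatorP S).1 Sb.
have d0 : 0 < (2 * M)^-1 by rewrite invr_gt0 mulr_gt0.
have [N hN] := compact_tail_bound hc d0.
pose h' i := if (i < N)%N then 0 else h i.
have h'B m n : block_bound h' (2 * M)^-1 m n.
  move=> c.
  have [nm_|mn] := leqP n (maxn m N).
    rewrite [X in nm X]big_nat_cond big1 ?nm0 ?expr0n/=; last first.
      move=> i /andP[/andP[mi im] _]; rewrite /h'; case: ltnP => [_|Ni].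
        by rewrite scaler0.
      by have := leq_trans im nm_; rewrite leq_max ltnNge mi/= ltnNge Ni.
    by rewrite mulr_ge0 ?sqr_ge0// sumr_ge0// => i _; rewrite sqr_ge0.
  have mm := leq_maxl m N.
  rewrite !(big_cat_nat mm (ltnW mn))/=.
  rewrite [X in nm (X + _)]big_nat_cond [X in nm (X + _)]big1 ?add0r; last first.
    move=> i /andP[/andP[mi im] _]; rewrite /h'; case: ltnP => [_|Ni].
      by rewrite scaler0.
    by move: im; rewrite leq_max ltnNge mi/= ltnNge Ni.
  have -> : \sum_(maxn m N <= i < n) c i *: h' i = \sum_(maxn m N <= i < n) c i *: h i.
    apply: eq_big_nat => i /andP[mi _]; rewrite /h' ltnNge.
    by rewrite (leq_trans (leq_maxr m N) mi).
  apply: le_trans (hN _ _ (leq_maxr m N) _) _.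
  rewrite mulrDr lerDr mulr_ge0 ?sqr_ge0// sumr_ge0// => i _; exact: sqr_ge0.
have [D DB DE] := block_bound_operator (ltW d0) h'B.
have [T' [S' [T'b S'b T'S' S'T' T'E]]] :=
  small_perturbation_invertible M0 Tb SM TS ST DB.
exists N, T', S'; split=> // i Ai; rewrite T'E DE// -fE// /h'.
by case: ifP; rewrite ?subr0.
Qed.

End Perturbation.

(** * Complements of index sets *)

Section Cardinalities.

Lemma card_eq_by_differences (A B : set nat) :
  (A `\` B #= B `\` A)%card -> (A #= B)%card.
Proof.
move=> AB; have [f] := elimT pcard_eqP (card_eqxx (A `&` B)).
have [|||g _] := @super_bij _ _ (A `&` B) A (A `&` B) B f.
- exact: subIsetl.
- exact: subIsetr.
- by rewrite !setDIr !setDv set0U setU0.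
by apply/pcard_eqP; squash g.
Qed.

Lemma card_eq_differences (T : choiceType) (F G : set T) :
  finite_set F -> (F #= G)%card -> (F `\` G #= G `\` F)%card.
Proof.
move=> Ff FG; have Gf : finite_set G by rewrite -(eq_finite_set FG).
apply/fcard_eq; try exact: finite_setD.
have cFG := elimT (fcard_eq Ff Gf) FG.
rewrite !fset_setD// !cardfsD cFG; congr (_ - _)%N.
by rewrite -!fset_setI// setIC.
Qed.

(** With [F] the part of [A] below [N], both complements arise from
    [~` A `|` `I_N] by removing equinumerous finite sets, [F] and [p @` F]. *)
Lemma card_setC_exchange (A : set nat) N (p : nat -> nat) :
  {in A &, injective p} -> (forall i, (N <= i)%N -> p i = i) ->
  (~` A #= ~` (p @` A))%card.
Proof.
move=> pinj pid; apply: card_eq_by_differences.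
pose F := A `&` `I_N; pose G := p @` F.
have Ff : finite_set F by apply: finite_setIr; exact: finite_II.
have FG : (F #= G)%card.
  rewrite card_eq_sym; apply: inj_card_eq => i j /set_mem[iA _] /set_mem[jA _].
  exact: pinj (mem_set iA) (mem_set jA).
have FGD := card_eq_differences Ff FG.
have inG i : A i -> (N <= i)%N -> ~ G i.
  move=> Ai Ni [j [Aj jN] pj]; move: (jN); rewrite /= ltnNge => /negP; apply.
  suff -> : j = i by [].
  by apply: (pinj _ _ (mem_set Aj) (mem_set Ai)); rewrite pj pid.
have -> : ~` A `\` ~` (p @` A) = G `\` F.
  apply/seteqP; split=> [i [nA /contrapT[j Aj pj]]|i [[j [Aj jN] pj] nF]].
    split; last by case=> Ai _; apply: nA.
    exists j => //; split=> //=; rewrite ltnNge; apply/negP => Nj.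
    by apply: nA; rewrite -pj pid.
  have nA : ~ A i.
    move=> Ai; case: (ltnP i N) => [iN|Ni]; first by apply: nF.
    by apply: (inG i) => //; exists j.
  by split=> //; apply; exists j.
have -> : ~` (p @` A) `\` ~` A = F `\` G.
  apply/seteqP; split=> [i [np /contrapT Ai]|i [[Ai iN] nG]].
    split; last by case=> j [Aj _] pj; apply: np; exists j.
    split=> //=; rewrite ltnNge; apply/negP => Ni; apply: np; exists i => //.
    exact: pid.
  split; last by apply.
  case=> j Aj pj; case: (ltnP j N) => [jN|Nj]; first by apply: nG; exists j.
  by move: iN; rewrite /= -pj pid// ltnNge Nj.
by rewrite card_eq_sym.
Qed.
End Cardinalities.

(** * Steinitz exchange and invariance of the excess *)

Section Exchange.
Variables (R : realType) (k : scalar_kind).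
Local Notation K := (scalars R k).
Variables (H : completeNormedModType K) (ip : {dot H for @scalar_conj R k}).
Hypothesis ip_norm : forall x : H, `|x| ^+ 2 = ip x x.

Lemma coordinate_bound (S : {linear H -> H}) (u : H) : bounded_operator S ->
  exists M : R, forall x, nm (ip (S x) u : K) <= M * nm x.
Proof.
move=> /bounded_operatorP[M M0 SM]; exists (M * nm u) => x.
by rewrite (le_trans (cauchy_schwarz ip_norm _ _))// mulrAC ler_wpM2r ?nm_ge0.
Qed.

Lemma coordinate_linear (S : {linear H -> H}) (u : H) (a : K) x y :
  ip (S (a *: x + y)) u = a * ip (S x) u + ip (S y) u.
Proof. by rewrite (linearP S) linearDl/= ipZl. Qed.

(** Steinitz exchange: since [g] is total, some [g l] has a nonzero coordinate
    along the basis vector that is to be replaced. *)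
Lemma steinitz_exchange (A : set nat) (e g u : nat -> H) (T S : {linear H -> H})
    (r : seq nat) :
  (forall i j, A i -> A j -> ip (e i) (e j) = (i == j)%:R) ->
  total_family setT g ->
  bounded_operator T -> bounded_operator S -> cancel T S -> cancel S T ->
  (forall i, A i -> T (e i) = u i) ->
  exists (T' S' : {linear H -> H}) (p : nat -> nat),
    [/\ bounded_operator T', bounded_operator S', cancel T' S', cancel S' T' &
      forall i, A i -> T' (e i) = if i \in r then g (p i) else u i].
Proof.
move=> eON gt Tb Sb TS ST TE; elim: r => [|j r].
  by exists T, S, id; split.
move=> [T1 [S1 [p [T1b S1b TS1 ST1 T1E]]]].
have [Aj|nAj] := pselect (A j); last first.
  exists T1, S1, p; split=> // i Ai; rewrite T1E// in_cons.
  by case: eqP => // ij; rewrite -ij in nAj.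
have [jr|jr] := boolP (j \in r).
  exists T1, S1, p; split=> // i Ai; rewrite T1E// in_cons.
  by case: eqP => // ->; rewrite jr.
have [l Sl] : exists l, ip (S1 (g l)) (e j) != 0.
  apply: contrapT => /forallNP nl.
  have [M bM] := coordinate_bound (e j) S1b.
  have := total_vanish (coordinate_linear S1 (e j)) bM gt.
  have h i : setT i -> ip (S1 (g i)) (e j) = 0.
    by move=> _; apply/eqP/negPn/negP; exact: nl.
  move=> /(_ h (T1 (e j))); rewrite TS1 eON// eqxx => /eqP.
  by rewrite oner_eq0.
have ejj : ip (e j) (e j) = 1 by rewrite eON// eqxx.
have [T2 [S2 [T2b S2b TS2 ST2 T2E]]] :=
  replace_invertible ip_norm T1b S1b TS1 ST1 ejj Sl.
exists T2, S2, (fun i => if i == j then l else p i); split=> // i Ai.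
rewrite T2E eON// in_cons; case: eqP => [->|_] /=.
  by rewrite scale1r addrC subrK.
by rewrite scale0r addr0 T1E.
Qed.

Lemma finite_span_comb (B : set nat) (f : nat -> H) (a : K) x y :
  finite_span B f x -> finite_span B f y -> finite_span B f (a *: x + y).
Proof.
have widen n N (c : nat -> K) : (n <= N)%N ->
    \sum_(0 <= i < n | i \in B) c i *: f i =
    \sum_(0 <= i < N | i \in B) (if (i < n)%N then c i else 0) *: f i.
  move=> nN; rewrite (big_cat_nat (leq0n n) nN)/= [X in _ + X]big_nat_cond.
  rewrite [X in _ + X]big1 ?addr0 => [|i /andP[/andP[ni _] _]]; last first.
    by rewrite ltnNge ni/= scale0r.
  rewrite big_nat_cond [RHS]big_nat_cond; apply: eq_bigr => i.
  by case/andP => /andP[_ ->].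
move=> [n [c ->]] [m [d ->]].
rewrite (widen _ _ _ (leq_maxl n m)) (widen _ _ _ (leq_maxr n m)).
eexists; eexists; rewrite scaler_sumr -big_split/=; apply: eq_bigr => i _.
by rewrite scalerA -scalerDl; reflexivity.
Qed.

Lemma finite_span_mono (A B : set nat) (f h : nat -> H) :
  (forall i, A i -> finite_span B h (f i)) -> finite_span A f `<=` finite_span B h.
Proof.
move=> AB _ [n [c ->]]; elim/big_rec: _ => [|i x iA ih].
  by exists 0%N, (fun=> 0); rewrite big_geq.
by apply: finite_span_comb => //; apply: AB; exact: set_mem.
Qed.

Lemma finite_span_mem (A : set nat) (f : nat -> H) i : A i -> finite_span A f (f i).
Proof.
move=> Ai; exists i.+1, (fun j => (j == i)%:R).
rewrite big_mkcond big_nat_recr//= mem_set// eqxx scale1r big_nat_cond big1 ?add0r//.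
move=> j /andP[/andP[_ ji] _]; case: ifP => // _.
by rewrite ltn_eqF// scale0r.
Qed.

(** Transporting [e] along [p] gives an orthonormal basis indexed by [p @` A].
    That [p] is injective on [A] is automatic, as [T] is injective and the [e i]
    are distinct. *)
Lemma riesz_basis_reindex (A : set nat) (e g : nat -> H) (T S : {linear H -> H})
    (p : nat -> nat) :
  orthonormal_basis ip A e ->
  bounded_operator T -> bounded_operator S -> cancel T S -> cancel S T ->
  (forall i, A i -> T (e i) = g (p i)) ->
  {in A &, injective p} /\ riesz_basis ip (p @` A) g.
Proof.
move=> [eON et] Tb Sb TS ST TE.
have pinj : {in A &, injective p}.
  move=> i j /set_mem Ai /set_mem Aj pij; apply/eqP/negPn/negP => ij.
  have : e i = e j by rewrite -[e i]TS -[e j]TS !TE// pij.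
  move=> eij; have := eON i i Ai Ai; rewrite {2}eij eON// (negbTE ij) eqxx => /eqP.
  by rewrite eq_sym oner_eq0.
split=> //; pose q j := xget 0%N [set i | A i /\ p i = j].
have pK i : A i -> q (p i) = i.
  move=> Ai; rewrite /q; case: xgetP => [i' _ [Ai' pi']|/(_ i)[]//].
  exact: pinj (mem_set Ai') (mem_set Ai) pi'.
exists (e \o q), T, S; split=> //; last by move=> _ [i Ai <-]; rewrite /= pK// TE.
split.
  move=> _ _ [i Ai <-] [j Aj <-] /=; rewrite !pK// eON//.
  by congr (nat_of_bool _)%:R; apply/eqP/eqP => [->//|/(pinj _ _ (mem_set Ai) (mem_set Aj))].
apply/seteqP; split=> // x _; have : closure (finite_span A e) x by rewrite et.
apply: closure_subset; apply: finite_span_mono => i Ai.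
have := @finite_span_mem (p @` A) (e \o q) (p i); rewrite /= pK//; apply.
by exists i.
Qed.

Lemma exists_kernel_vector (n m : nat) (M : 'M[K]_(n, m)) : (m < n)%N ->
  exists a : 'rV[K]_n, a != 0 /\ a *m M = 0.
Proof.
move=> mn; have : kermx M != 0.
  rewrite -mxrank_eq0 mxrank_ker -lt0n subn_gt0.
  exact: leq_ltn_trans (rank_leq_col M) mn.
case/rowV0Pn => a /sub_kermxP aM a0; by exists a.
Qed.

(** The coordinate functionals along [u i], [i] in [r1], vanish on the [u j] with
    [j] in both index sets. If there were fewer vectors [u j], [j] in [r2], than
    functionals, a nontrivial combination of the functionals would vanish on the
    whole second basis, hence everywhere, although its value at [u i] is its
    [i]-th coefficient. *)
Lemma riesz_basis_difference_le (A1 A2 : set nat) (u : nat -> H) (r1 r2 : seq nat) :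
  riesz_basis ip A1 u -> riesz_basis ip A2 u -> uniq r1 ->
  (forall i, i \in r1 -> (A1 `\` A2) i) ->
  (forall i, (A2 `\` A1) i -> i \in r2) ->
  (size r1 <= size r2)%N.
Proof.
move=> [e1 [T1 [S1 [[e1ON _] T1b S1b [TS1 ST1] u1]]]].
move=> [e2 [T2 [S2 [[_ e2t] T2b S2b [TS2 ST2] u2]]]] r1u r1A r2A.
rewrite leqNgt; apply/negP => lt21.
set n := size r1 in lt21; set m := size r2 in lt21.
pose s1 (i : 'I_n) := nth 0%N r1 i; pose s2 (j : 'I_m) := nth 0%N r2 j.
have s1A i : (A1 `\` A2) (s1 i) by apply: r1A; apply: mem_nth.
pose co i x := ip (S1 x) (e1 i).
have [a [a0 aM]] := exists_kernel_vector
  (\matrix_(i < n, j < m) co (s1 i) (u (s2 j))) lt21.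
pose phi x := \sum_(i < n) a 0 i * co (s1 i) x.
have phi_lin (b : K) x y : phi (b *: x + y) = b * phi x + phi y.
  rewrite /phi mulr_sumr -big_split/=; apply: eq_bigr => i _.
  by rewrite /co coordinate_linear mulrDr mulrCA.
have co1 i j : A1 i -> A1 j -> co j (u i) = (i == j)%:R.
  by move=> Ai Aj; rewrite /co u1// TS1 e1ON.
have phi0 j : A2 j -> phi (u j) = 0.
  move=> A2j; have [A1j|nA1j] := pselect (A1 j).
    rewrite /phi big1// => i _; rewrite co1//; last by case: (s1A i).
    case: eqP => [ji|_]; last by rewrite mulr0.
    by have [_] := s1A i; rewrite -ji.
  have jr2 : j \in r2 by apply: r2A.
  have jm : (index j r2 < m)%N by rewrite index_mem.
  have := congr1 (fun v : 'rV_m => v 0 (Ordinal jm)) aM; rewrite !mxE => <-.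
  by apply: eq_bigr => i _; rewrite mxE /s2/= nth_index.
have phib : exists M : R, forall x, nm (phi x : K) <= M * nm x.
  have /choice[Mf MfP] : forall i : 'I_n, exists M : R,
    forall x, nm (co (s1 i) x : K) <= M * nm x by move=> i; exact: coordinate_bound.
  exists (\sum_(i < n) nm (a 0 i : K) * Mf i) => x.
  apply: le_trans (nm_sum _ _ _) _; rewrite mulr_suml; apply: ler_sum => i _.
  by rewrite nmM -mulrA ler_wpM2l ?nm_ge0.
have [M phiM] := phib; have [N N0 T2N] := (bounded_operatorP T2).1 T2b.
have phiT2 x : phi (T2 x) = 0.
  apply: (@total_vanish _ _ _ A2 e2 (phi \o T2) (`|M| * N)) => //.
  - by move=> b v w /=; rewrite (linearP T2) phi_lin.
  - move=> y /=; rewrite (le_trans (phiM _))//.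
    apply: (@le_trans _ _ (`|M| * nm (T2 y))).
      by rewrite ler_wpM2r ?nm_ge0 ?ler_norm.
    by rewrite -mulrA ler_wpM2l.
  - by move=> i A2i /=; rewrite -u2// phi0.
case/eqP: a0; apply/rowP => i; rewrite mxE.
have := phiT2 (S2 (u (s1 i))); rewrite ST2 /phi (bigD1 i)//= big1 ?addr0.
  by rewrite co1 ?eqxx ?mulr1//; case: (s1A i).
move=> j ji; rewrite co1; [|by case: (s1A i)|by case: (s1A j)].
by rewrite /s1 nth_uniq// eq_sym (inj_eq val_inj) (negbTE ji) mulr0.
Qed.

(** The two index sets differ by equally many elements on either side; finiteness
    of [sigma] makes the differences finite. *)
Lemma riesz_basis_complement_card (sigma tau : set nat) (u : nat -> H) :
  riesz_basis ip (~` sigma) u -> riesz_basis ip (~` tau) u ->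
  finite_set sigma -> (sigma #= tau)%card.
Proof.
move=> rs rt fs.
have D1 : (~` tau `\` ~` sigma) = sigma `\` tau by rewrite setDE setCK setIC setDE.
have D2 : (~` sigma `\` ~` tau) = tau `\` sigma by rewrite setDE setCK setIC setDE.
have fst : finite_set (sigma `\` tau) by exact: finite_setD.
have [r rE] := (finite_seqP _).1 fst.
have fts : finite_set (tau `\` sigma).
  apply: contrapT => /(@infinite_set_fset _ _ (size r).+1)[B BA].
  apply/negP; rewrite -ltnNge ltnS.
  apply: (riesz_basis_difference_le rs rt (finmap.fset_uniq B)).
    by move=> i iB; rewrite D2; exact: BA.
  by move=> i; rewrite D1 rE.
apply: card_eq_by_differences; apply/fcard_eq => //.
apply/eqP; rewrite eqn_leq; apply/andP; split.
  apply: (riesz_basis_difference_le rt rs (finmap.fset_uniq _)).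
    by move=> i; rewrite in_fset_set// D1 => /set_mem.
  by move=> i; rewrite D2 in_fset_set// => /mem_set.
apply: (riesz_basis_difference_le rs rt (finmap.fset_uniq _)).
  by move=> i; rewrite in_fset_set// D2 => /set_mem.
by move=> i; rewrite D1 in_fset_set// => /mem_set.
Qed.

End Exchange.

(** * Frames *)

Section Frames.
Variables (R : realType) (k : scalar_kind).
Local Notation K := (scalars R k).
Variables (H : completeNormedModType K) (ip : {dot H for @scalar_conj R k}).
Hypothesis ip_norm : forall x : H, `|x| ^+ 2 = ip x x.

Definition bessel_bound (f : nat -> H) (B : R) := forall x n,
  \sum_(0 <= i < n) nm (ip x (f i) : K) ^+ 2 <= B * nm x ^+ 2.

Lemma frame_bessel (f : nat -> H) : frame ip f -> exists B, bessel_bound f B.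
Proof.
move=> [a [b [_ b0 ab]]]; exists (real_value b) => x n.
have [cv _ ub] := ab x.
have E : (fun i => `|ip x (f i)| ^+ 2) =
    (fun i => of_real k (nm (ip x (f i) : K) ^+ 2)).
  by apply/funext => i; rewrite nm_sqr.
rewrite E in cv ub.
apply: le_trans (nonneg_series_partial _ cv n) _.
  by move=> i; exact: sqr_ge0.
apply: le_trans (real_value_le ub) _.
by rewrite -[b in leLHS]real_valueK ?(ltW b0)// nm_sqr -of_realM of_realK.
Qed.

(** Duality: pairing [x] with the synthesis of the coefficients [<x, h i>] gives
    the sum of their squares. *)
Lemma block_bound_bessel (h : nat -> H) (B : R) :
  (forall m n, block_bound h B m n) -> bessel_bound h (B ^+ 2).
Proof.
move=> hB x n; set s := \sum_(0 <= i < n) _.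
have s0 : 0 <= s by apply: sumr_ge0 => i _; exact: sqr_ge0.
have := hB 0%N n (fun i => ip x (h i)); rewrite -/s; set z := \sum_(_ <= i < _) _.
have xz : ip x z = of_real k s.
  rewrite ip_sumr of_real_sum; apply: eq_bigr => i _.
  by rewrite ipZr mulrC mul_conj nm_sqr.
have := cauchy_schwarz ip_norm x z; rewrite xz nm_of_real ger0_norm// => sxz zB.
have [->|sn0] := eqVneq s 0; first by rewrite mulr_ge0// sqr_ge0.
have sp : 0 < s by rewrite lt_neqAle eq_sym sn0.
rewrite -(ler_pM2r sp) -expr2.
apply: (@le_trans _ _ ((nm x * nm z) ^+ 2)).
  by apply: lerXn2r; rewrite ?nnegrE ?mulr_ge0 ?nm_ge0.
rewrite exprMn [leRHS](_ : _ = nm x ^+ 2 * (B ^+ 2 * s)); last by ring.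
by rewrite ler_wpM2l ?sqr_ge0.
Qed.

Lemma bessel_boundB (f h : nat -> H) (B C : R) :
  bessel_bound f B -> bessel_bound h C ->
  bessel_bound (fun i => f i - h i) (2 * B + 2 * C).
Proof.
move=> fB hC x n.
apply: (@le_trans _ _ (\sum_(0 <= i < n)
    (2 * nm (ip x (f i) : K) ^+ 2 + 2 * nm (ip x (h i) : K) ^+ 2))).
  apply: ler_sum => i _; rewrite linearBr/=.
  set u := (ip x (f i) : K); set v := (ip x (h i) : K).
  apply: (@le_trans _ _ ((nm u + nm v) ^+ 2)).
    by apply: lerXn2r (nmB _ _); rewrite nnegrE ?addr_ge0 ?nm_ge0.
  by have := sqr_ge0 (nm u - nm v); lra.
rewrite big_split/= -!mulr_sumr.
rewrite [leRHS](_ : _ = 2 * (B * nm x ^+ 2) + 2 * (C * nm x ^+ 2)); last by ring.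
by rewrite lerD// ler_wpM2l.
Qed.

(** The lower frame bound: [nm x ^+ 2] is [<x, T (S x)>], and [S x] is close to a
    finite combination of the [e i], so that the pairing is controlled by the
    numbers [<x, T (e i)>] through the inequality of means. *)
Lemma riesz_basis_lower_bound (A : set nat) (g : nat -> H) :
  riesz_basis ip A g -> exists2 a : R, 0 < a &
    forall x s, (forall n, \sum_(0 <= i < n) nm (ip x (g i) : K) ^+ 2 <= s) ->
      a * nm x ^+ 2 <= s.
Proof.
move=> [e [T [S [[eON et] Tb Sb [TS ST] gE]]]].
have [L L0 TL] := (bounded_operatorP T).1 Tb.
have [N N0 SN] := (bounded_operatorP S).1 Sb.
exists (8 * N ^+ 2)^-1 => [|x s hs]; first by rewrite invr_gt0 mulr_gt0// exprn_gt0.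
have [x0|xn0] := eqVneq (nm x) 0.
  by rewrite x0 expr0n mulr0; have := hs 0%N; rewrite big_geq.
have xp : 0 < nm x by rewrite lt_neqAle eq_sym xn0 nm_ge0.
(* [d <= N] keeps [y] comparable to [x]; [L * d <= 1 / 4] lets the error made in
   replacing [S x] by [y] be absorbed in [nm x ^+ 2]. *)
pose d := Num.min N (4 * L)^-1.
have dN : d <= N by rewrite ge_min lexx.
have dL : L * d <= 4^-1.
  by rewrite -ler_pdivlMl// -invfM [L * 4]mulrC ge_min lexx orbT.
have d0 : 0 < d by rewrite lt_min N0 invr_gt0 mulr_gt0.
have : closure (finite_span A e) (S x) by rewrite et.
move=> /closure_nmP/(_ _ (mulr_gt0 d0 xp))[y [n [c yE]] Sxy].
have ny : nm y <= 2 * N * nm x.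
  have := SN x; have := le_nmB y (S x); rewrite nm_distC.
  have := ler_wpM2r (ltW xp) dN; lra.
have ny2 : nm y ^+ 2 <= 4 * N ^+ 2 * nm x ^+ 2.
  have -> : 4 * N ^+ 2 * nm x ^+ 2 = (2 * N * nm x) ^+ 2 by ring.
  by apply: lerXn2r => //; rewrite nnegrE ?nm_ge0 ?mulr_ge0 ?(ltW N0) ?(ltW xp).
have yON := nm2_sum_orthonormal ip_norm eON 0 n c (P := mem A) (fun i => set_mem).
rewrite -yE in yON.
(* The weights of the inequality of means are chosen so that the part in [y] is
   at most half of [nm x ^+ 2]. *)
have main : nm (ip x (T y) : K) <= 8^-1 / N ^+ 2 * nm y ^+ 2 + 2 * N ^+ 2 * s.
  rewrite {1}yE linear_sum ip_sumr; apply: le_trans (nm_sum _ _ _) _.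
  apply: (@le_trans _ _ (\sum_(0 <= i < n | i \in A)
      (8^-1 / N ^+ 2 * nm (c i) ^+ 2 + 2 * N ^+ 2 * nm (ip x (g i) : K) ^+ 2))).
    apply: ler_sum => i /set_mem Ai; rewrite linearZ/= -gE// ipZr nmM nm_conj.
    move: (nm (c i)) (nm (ip x (g i) : K)) => a b; rewrite -subr_ge0.
    have -> : 8^-1 / N ^+ 2 * a ^+ 2 + 2 * N ^+ 2 * b ^+ 2 - a * b =
        2 * (N * b - 4^-1 / N * a) ^+ 2 by field; rewrite (gt_eqF N0).
    by rewrite mulr_ge0// sqr_ge0.
  rewrite big_split/= -!mulr_sumr -yON lerD2l ler_wpM2l//.
    by rewrite mulr_ge0// sqr_ge0.
  apply: le_trans (hs n); rewrite big_mkcond; apply: ler_sum => i _.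
  by case: ifP => // _; exact: sqr_ge0.
have xx : nm x ^+ 2 = nm (ip x x : K).
  by rewrite (nm2_ip ip_norm) nm_scalar -ip_norm ger0_norm// exprn_ge0.
have split_x : nm x ^+ 2 <= nm x * (L * (d * nm x)) + nm (ip x (T y) : K).
  rewrite xx -{2}(ST x) -[S x](subrK y) linearD linearDr/=.
  apply: le_trans (nmD _ _) _; rewrite lerD2r.
  apply: le_trans (cauchy_schwarz ip_norm _ _) _; rewrite ler_wpM2l ?nm_ge0//.
  by apply: le_trans (TL _) _; rewrite ler_wpM2l ?ltW.
have h1 : nm x * (L * (d * nm x)) <= 4^-1 * nm x ^+ 2.
  have -> : nm x * (L * (d * nm x)) = L * d * nm x ^+ 2 by ring.
  by rewrite ler_wpM2r// sqr_ge0.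
have N2 : 0 < N ^+ 2 by rewrite exprn_gt0.
have h2 : 8^-1 / N ^+ 2 * nm y ^+ 2 <= 2^-1 * nm x ^+ 2.
  rewrite -mulrA ler_pdivrMl// ler_pdivrMl//.
  have -> : N ^+ 2 * (8 * (2^-1 * nm x ^+ 2)) = 4 * N ^+ 2 * nm x ^+ 2 by field.
  by [].
by rewrite ler_pdivrMl ?mulr_gt0//; lra.
Qed.

Lemma frame_of_bounds (g : nat -> H) (B : R) (A : set nat) :
  bessel_bound g B -> riesz_basis ip A g -> frame ip g.
Proof.
move=> gB /riesz_basis_lower_bound[a a0 low].
exists (of_real k a), (of_real k (`|B| + 1)); split.
- by rewrite -[0](of_real0 R k) of_real_lt.
- by rewrite -[0](of_real0 R k) of_real_lt ltr_wpDl.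
move=> x s; pose b i := nm (ip x (g i) : K) ^+ 2.
have b0 i : 0 <= b i by exact: sqr_ge0.
have sE : s = series (fun i => of_real k (b i)).
  by congr series; apply/funext => i; rewrite nm_sqr.
have [l cl [lb lB]] := nonneg_series_cvgn k b0 (gB x).
rewrite sE (cvg_lim _ cl)// nm_sqr -!of_realM !of_real_le; split.
- by [].
- exact: low lb.
- apply: le_trans lB _; rewrite ler_wpM2r ?sqr_ge0//; have := ler_norm B; lra.
Qed.

(** * Transfer of a Riesz basis *)

(** After the small perturbation the basis consists of members of [g] except at
    the indices below [N], where the exchange takes place. *)
Lemma riesz_basis_transfer (f g : nat -> H) (sigma : set nat) :
  total_family setT g -> synthesis_compact (fun i => f i - g i) ->
  riesz_basis ip (~` sigma) f ->
  exists2 tau, riesz_basis ip (~` tau) g & (sigma #= tau)%card.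
Proof.
move=> gt hc [e [T [S [eB Tb Sb [TS ST] fE]]]].
have [eON _] := eB.
have [N [T1 [S1 [T1b S1b TS1 ST1 T1E]]]] :=
  tail_perturbation ip_norm eON Tb Sb TS ST fE hc.
have [T2 [S2 [p [T2b S2b TS2 ST2 T2E]]]] :=
  steinitz_exchange ip_norm (iota 0 N) eON gt T1b S1b TS1 ST1 T1E.
pose q i := if (i < N)%N then p i else i.
have qE i : (~` sigma) i -> T2 (e i) = g (q i).
  move=> Ai; rewrite T2E// mem_iota /q/= add0n; case: ifP => // iN.
  by rewrite iN subKr.
have [qinj gR] := riesz_basis_reindex eB T2b S2b TS2 ST2 qE.
exists (~` (q @` (~` sigma))); first by rewrite setCK.
have := @card_setC_exchange (~` sigma) N q qinj; rewrite setCK; apply.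
by move=> i Ni; rewrite /q ltnNge Ni.
Qed.

End Frames.


Theorem theorem10 (R : realType) (k : scalar_kind)
    (H : completeNormedModType (scalars R k))
    (ip : {dot H for @scalar_conj R k})
    (ip_norm : forall x : H, `|x| ^+ 2 = ip x x)
    (H_separable : separable_space H)
    (f g : nat -> H)
    (f_frame : frame ip f)
    (f_riesz : contains_riesz_basis ip f)
    (g_total : total_family setT g)
    (K_well_defined : synthesis_well_defined (fun i => f i - g i))
    (K_compact : synthesis_compact (fun i => f i - g i)) :
  [/\ frame ip g,
      contains_riesz_basis ip g &
      forall m n : option nat, has_excess ip f m -> has_excess ip g n -> m = n].
Proof.
have [sigma fR] := f_riesz.
have [tau gR _] := riesz_basis_transfer ip_norm g_total K_compact fR.
split; last 2 first.
- by exists tau.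
- move=> m n [s fs sm] [t gt tn].
  have [t' gt' st'] := riesz_basis_transfer ip_norm g_total K_compact fs.
  have s_tt' : finite_set s -> (s #= t)%card.
    move=> sf; apply: (card_eq_trans st').
    apply: (riesz_basis_complement_card ip_norm gt' gt).
    by rewrite -(eq_finite_set st').
  have t_tt' : finite_set t -> finite_set s.
    move=> tf; rewrite (eq_finite_set st').
    by rewrite -(eq_finite_set (riesz_basis_complement_card ip_norm gt gt' tf)).
  case: m n sm tn => [m|] [n|] //= sm tn.
  + have sf : finite_set s by apply/finite_setP; exists m.
    congr Some; apply/card_eq_II.
    by rewrite card_eq_sym in sm; exact: card_eq_trans sm (card_eq_trans (s_tt' sf) tn).
  + exfalso; apply: tn.
    have sf : finite_set s by apply/finite_setP; exists m.
    by rewrite -(eq_finite_set (s_tt' sf)).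
  + by exfalso; apply/sm/t_tt'/finite_setP; exists n.
have [B fB] := frame_bessel f_frame.
have [M _ hM] := compact_block_bound K_compact.
have := bessel_boundB fB (block_bound_bessel ip_norm hM).
have -> : (fun i => f i - (f i - g i)) = g.
  by apply/funext => i; rewrite subKr.
by move=> gB; exact: frame_of_bounds ip_norm _ _ _ gB gR.
Qed.
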